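(* Let $\mathcal{A},\mathcal{B}\subseteq M_n$ be unital commutative $*$-subalgebras of $M_n$, written as $$\mathcal{A} = U\Big(\bigoplus_{k=1}^{d_1}\mathbb{C}I_{m_k}\Big)U^*,\qquad \mathcal{B} = V\Big(\bigoplus_{k=1}^{d_2}\mathbb{C}I_{n_k}\Big)V^*,$$ where $U,V\in M_n$ are unitary and $m_1,\dots,m_{d_1}$, $n_1,\dots,n_{d_2}$ are positive integers with $\sum_{k=1}^{d_1}m_k=n=\sum_{k=1}^{d_2}n_k$. Let $X=X(U,V)$ be their block-index matrix, and let $r=(m_1,\dots,m_{d_1})$, $c=(n_1,\dots,n_{d_2})$. Then $$Q(\mathcal{A},\mathcal{B})=\|Y(X;r,c)\|_F^2.$$
   Context: $M_n$ is the algebra of $n\times n$ complex matrices with trace inner product $\langle X,Y\rangle=\mathrm{Tr}(XY^* )$; $\|\cdot\|_F$ is the Frobenius norm. A unital $*$-subalgebra of $M_n$ is a complex subalgebra closed under conjugate transpose and containing $I_n$. Measure of orthogonality: for unital $*$-subalgebras $\mathcal{A},\mathcal{B}\subseteq M_n$, let $\mathcal{E}_{\mathcal{A}}:M_n\to M_n$ be the trace-preserving conditional expectation onto $\mathcal{A}$, i.e. the orthogonal projection of $M_n$ onto $\mathcal{A}$ in the trace inner product, and similarly $\mathcal{E}_{\mathcal{B}}$. Then $Q(\mathcal{A},\mathcal{B}):=\mathrm{Tr}(T_{\mathcal{A}}T_{\mathcal{B}})$, where $T_{\mathcal{A}},T_{\mathcal{B}}$ are the matrices of $\mathcal{E}_{\mathcal{A}},\mathcal{E}_{\mathcal{B}}$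 as linear operators on the vector space $M_n$ in a common basis. Equivalently, $Q(\mathcal{A},\mathcal{B})=\sum_{i,j}|\mathrm{Tr}(A_iB_j)|^2$ for orthonormal bases $\{A_i\}$ of $\mathcal{A}$ and $\{B_j\}$ of $\mathcal{B}$ in the trace inner product. Block-index matrix: $X(U,V)=(U^*V)\circ(\overline{U^*V})$, where $\circ$ is the entrywise (Schur) product and the bar is entrywise conjugation; that is, the $(i,j)$ entry of $X$ is $|(U^*V)_{i,j}|^2$. The matrix $Y(X;r,c)$: given $r=(m_1,\dots,m_{d_1})$ and $c=(n_1,\dots,n_{d_2})$ (tuples of positive integers each summing to $n$), partition the rows of the $n\times n$ matrix $X$ into consecutive groups of sizes $m_1,\dots,m_{d_1}$ and the columns into consecutive groups of sizes $n_1,\dots,n_{d_2}$. Then $Y(X;r,c)=[y_{i,j}]$ is the $d_1\times d_2$ matrix with $y_{i,j}$ equal to $\frac{1}{\sqrt{m_in_j}}$ times the sum of all entries in the $(i,j)$-block of $X$. *)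

(* Defs.v *)
From HB Require Import structures.
From mathcomp Require Import all_boot all_order all_algebra.
From mathcomp Require Import sesquilinear spectral.
From mathcomp Require Import reals complex.

Set Implicit Arguments.
Unset Strict Implicit.
Unset Printing Implicit Defensive.

Import Order.TTheory GRing.Theory Num.Theory.
Import passmx.

Local Open Scope ring_scope.
Local Open Scope sesquilinear_scope.

Definition trdot (C : numClosedFieldType) (n : nat) (X Y : 'M[C]_n) : C :=
  \tr (X *m Y ^t*).

(* The instances below make the library's [orthov] and [orthonormal] available
   for the trace inner product. *)
Section TraceInnerProduct.
Context {C : numClosedFieldType} {n : nat}.
Implicit Types X Y : 'M[C]_n.

Fact trdot_is_linear Y : linear_for *%R (@trdot C n ^~ Y).
Proof.
by move=> a X X'; rewrite /trdot mulmxDl -scalemxAl mxtraceD mxtraceZ.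
Qed.

Fact trdotr_is_linear X : linear_for (Num.conj \; *%R) (trdot X).
Proof.
move=> a Y Y'; rewrite /trdot linearP /= map_mxD map_mxZ mulmxDr -scalemxAr.
by rewrite mxtraceD mxtraceZ.
Qed.

HB.instance Definition _ := bilinear_isBilinear.Build C 'M[C]_n 'M[C]_n C
  *%R (Num.conj \; *%R) (@trdot C n) (trdot_is_linear, trdotr_is_linear).

Fact trdot_herm X Y : trdot X Y = (-1) ^+ false * (trdot Y X)^*.
Proof.
rewrite mul1r /trdot -trace_map_mx -[LHS]mxtrace_tr trmx_mul map_mxM.
congr (\tr (_ *m _)); first by rewrite -map_trmx trmxK.
by apply/matrixP => i j; rewrite !mxE /= conjCK.
Qed.

HB.instance Definition _ := isHermitianSesquilinear.Build C 'M[C]_n false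
  Num.conj (@trdot C n) trdot_herm.

Fact trdotE X : trdot X X = \sum_i \sum_j `|X i j| ^+ 2.
Proof.
apply: eq_bigr => i _; rewrite mxE; apply: eq_bigr => j _.
by rewrite !mxE -normCK.
Qed.

Fact trdot_gt0 X : X != 0 -> 0 < trdot X X.
Proof.
have ge0 i : 0 <= \sum_j `|X i j| ^+ 2.
  by apply: sumr_ge0 => j _; rewrite exprn_ge0.
move=> X0; rewrite lt0r trdotE sumr_ge0 ?andbT//.
apply: contra X0; rewrite psumr_eq0// => /allP s0.
apply/eqP/matrixP => i j; rewrite mxE; apply/eqP.
move: (s0 i (mem_index_enum i)); rewrite /= psumr_eq0 => [|k _]; last first.
  by rewrite exprn_ge0.
by move/allP/(_ j (mem_index_enum j)); rewrite /= expf_eq0/= normr_eq0.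
Qed.

HB.instance Definition _ :=
  isDotProduct.Build C 'M[C]_n (@trdot C n) trdot_gt0.

End TraceInnerProduct.

Definition unital_star_subalgebra (C : numClosedFieldType) (n : nat)
    (A : {vspace 'M[C]_n}) : Prop :=
  [/\ 1%:M \in A,
      {in A &, forall X Y, X *m Y \in A} &
      {in A, forall X, X ^t* \in A}].

Definition commutative_subalgebra (C : numClosedFieldType) (n : nat)
    (A : {vspace 'M[C]_n}) : Prop :=
  {in A &, forall X Y, X *m Y = Y *m X}.

(* Projection onto A along the orthogonal complement of A, see [cond_expP]. *)
Definition cond_exp (C : numClosedFieldType) (n : nat)
    (A : {vspace 'M[C]_n}) : 'End('M[C]_n) :=
  daddv_pi A (orthov (@trdot C n) A).

(* [mxof] acts on row vectors, so T_A is the transpose of the matrix of E_A in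
   the column convention; Tr (T_A T_B) is unaffected. It does not depend on the
   basis either, see [orth_measure_basis]. *)
Definition orth_measure (C : numClosedFieldType) (n : nat)
    (A B : {vspace 'M[C]_n}) : C :=
  let e := vbasis {:'M[C]_n} in
  \tr (mxof e e (cond_exp A) *m mxof e e (cond_exp B)).

Definition frobenius_norm (C : numClosedFieldType) (m n : nat)
    (M : 'M[C]_(m, n)) : C :=
  sqrtC (\sum_i \sum_j `|M i j| ^+ 2).

Definition block_index_matrix (C : numClosedFieldType) (n : nat)
    (U V : 'M[C]_n) : 'M[C]_n :=
  let W := U ^t* *m V in map2_mx *%R W (map_mx Num.conj W).

Definition block_scalar_mx (C : numClosedFieldType) (n d : nat)
    (m : 'I_d -> nat) (hm : (\sum_k m k)%N = n) (a : 'I_d -> C) : 'M[C]_n :=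
  castmx (hm, hm) (\mxdiag_(k < d) ((a k)%:M : 'M[C]_(m k))).

Definition block_sum_mx (C : numClosedFieldType) (n d1 d2 : nat)
    (r : 'I_d1 -> nat) (c : 'I_d2 -> nat)
    (hr : (\sum_k r k)%N = n) (hc : (\sum_k c k)%N = n) (X : 'M[C]_n) :
    'M[C]_(d1, d2) :=
  \matrix_(i, j) ((sqrtC (r i * c j)%N%:R)^-1 *
    \sum_a \sum_b submxblock (castmx (esym hr, esym hc) X) i j a b).

Section ConditionalExpectation.
Context {C : numClosedFieldType} {n : nat}.
Implicit Types (A B : {vspace 'M[C]_n}) (X Y : 'M[C]_n).

Lemma orthov_trdot_direct A : (A :&: orthov (@trdot C n) A)%VS = 0%VS.
Proof.
apply/eqP; rewrite -subv0; apply/subvP => X; rewrite memv_cap memv0.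
case/andP=> XA /mem_orthovP/(_ X XA) XX0; apply/negPn/negP => /trdot_gt0.
by rewrite XX0 ltxx.
Qed.

Let trdot_row A X := \row_(i < \dim A) trdot X (vbasis A)`_i.

Let trdot_row_linear A : linear (trdot_row A).
Proof.
move=> a Y Z; apply/rowP => i; rewrite !mxE.
exact: (trdot_is_linear (vbasis A)`_i a Y Z).
Qed.

HB.instance Definition _ A := GRing.isLinear.Build C 'M[C]_n 'rV[C]_(\dim A)
  *:%R (trdot_row A) (trdot_row_linear A).

Lemma addv_orthov_trdot A : (A + orthov (@trdot C n) A)%VS = fullv.
Proof.
pose f := linfun (trdot_row A).
have fE X : f X = trdot_row A X by rewrite lfunE.
have kf : (lker f <= orthov (@trdot C n) A)%VS.
  apply/subvP => X; rewrite memv_ker fE => /eqP/rowP f0.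
  apply/mem_orthovP => Y /coord_vbasis ->; rewrite linear_sumr/= big1// => i _.
  by rewrite linearZr_LR/=; have := f0 i; rewrite !mxE => ->; rewrite mulr0.
apply/eqP; rewrite -dimv_leqif_eq ?subvf// eqn_leq dimvS ?subvf//=.
rewrite dimv_disjoint_sum ?orthov_trdot_direct//.
rewrite -(limg_ker_dim f fullv) capfv addnC leq_add ?dimvS//.
have dimA : \dim {:'rV[C]_(\dim A)} = \dim A.
  by rewrite dimvf dim_matrix [LHS]mul1n.
by rewrite -[X in (_ <= X)%N]dimA dimvS ?subvf.
Qed.

Lemma cond_expP A X Z : Z = cond_exp A X <->
  Z \in A /\ {in A, forall Y, trdot (X - Z) Y = 0}.
Proof.
have EX : X - cond_exp A X \in orthov (@trdot C n) A.
  have XA : X \in (A + orthov (@trdot C n) A)%VS.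
    by rewrite addv_orthov_trdot memvf.
  rewrite -{1}(daddv_pi_add (orthov_trdot_direct A) XA) addrC addKr.
  exact: memv_pi.
split=> [-> | [ZA /mem_orthovP XZ]].
  by split; [exact: memv_pi | exact/mem_orthovP].
apply/eqP; rewrite -subr_eq0 -memv0 -(orthov_trdot_direct A) memv_cap.
rewrite rpredB ?memv_pi//=.
have -> : Z - cond_exp A X = X - cond_exp A X - (X - Z).
  by rewrite opprB [RHS]addrC addrA subrK.
by rewrite rpredB.
Qed.

Lemma orth_measure_basis (e : (\dim {:'M[C]_n}).-tuple 'M[C]_n) A B :
  basis_of fullv e ->
  orth_measure A B = \tr (mxof e e (cond_exp A) *m mxof e e (cond_exp B)).
Proof.
move=> be; have b0 := vbasisP {:'M[C]_n}; rewrite /orth_measure.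
set b := vbasis _ in b0 *.
rewrite -!mxof_comp//; set f := (_ \o _)%VF.
rewrite -[f in LHS]comp_lfun1l -[f in LHS]comp_lfun1r.
rewrite (mxof_comp b b be) (mxof_comp b e be) mxtrace_mulC mulmxA.
by rewrite -mxof_comp// comp_lfun1l mxof1 ?mul1mx// (basis_free be).
Qed.

End ConditionalExpectation.

(* Main.v *)
(* For orthonormal bases E_i of A and F_j of B, the composite of the two
   conditional expectations is the sum of the rank-one maps
   X |-> <X, E_i> <E_i, F_j> F_j, whose trace is the sum of |<E_i, F_j>|^2.
   With P_i the projection onto the i-th block, the matrices
   U P_i U^-1 / sqrt m_i form such a basis of A, and likewise for B with V.
   For W = U^-1 V the product <U P_i U^-1, V P_j V^-1> = Tr (P_i W P_j W^-1)
   is the sum of the |W_pq|^2 over the (i,j)-block, so <E_i, F_j> is the entry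
   y_ij of Y. *)

Require Import Defs.
From mathcomp Require Import all_boot all_order all_algebra.
From mathcomp Require Import sesquilinear spectral reals complex.

Set Implicit Arguments.
Unset Strict Implicit.
Unset Printing Implicit Defensive.

Local Open Scope ring_scope.
Local Open Scope sesquilinear_scope.

Import Order.TTheory GRing.Theory Num.Theory.
Import passmx.

Section OrthonormalFamilies.
Context {C : numClosedFieldType} {n : nat}.
Implicit Types (A B : {vspace 'M[C]_n}) (X Y : 'M[C]_n).

Lemma trdotC X Y : trdot Y X = (trdot X Y)^*.
Proof. by rewrite trdot_herm mul1r. Qed.

(** Cyclicity of the trace carries the outer [U] to the end, so that [U] and [V] enter only through
    [U ^t* *m V]. *)
Lemma trdot_unitary_conj (U V D E : 'M[C]_n) :
  trdot (U *m D *m U ^t*) (V *m E *m V ^t*) =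
  trdot (D *m (U ^t* *m V)) ((U ^t* *m V) *m E).
Proof.
rewrite /trdot !(trmx_mul, map_mxM) /= !trmxCK !mulmxA.
by rewrite -!mulmxA mxtrace_mulC !mulmxA.
Qed.

(** By [cond_expP], it is enough that the Fourier sum lies in [A] and that the remainder is
    orthogonal to each [E j], where only the [j]-th term contributes. *)
Lemma cond_exp_orthonormal d (E : 'I_d -> 'M[C]_n) A X :
    (forall i j, trdot (E i) (E j) = (i == j)%:R) ->
    (forall Y, Y \in A <-> exists a : 'I_d -> C, Y = \sum_i a i *: E i) ->
  cond_exp A X = \sum_i trdot X (E i) *: E i.
Proof.
move=> orthE spanE; apply/esym/cond_expP; split.
  by apply/spanE; exists (fun i => trdot X (E i)).
move=> _ /spanE[a ->]; rewrite linear_sumr big1 //= => j _.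
rewrite linearZr_LR /= linearBl /= linear_sumlz /= (bigD1 j) //= linearZl_LR /=.
rewrite orthE eqxx big1 => [|i ij]; last first.
  by rewrite linearZl_LR /= orthE (negPf ij) mulr0.
by rewrite mulr1 addr0 subrr mulr0.
Qed.

Lemma mxtrace_mxof_finite_rank (I : finType) (P Q : I -> 'M[C]_n)
    (f : 'End('M[C]_n)) (e : (\dim {:'M[C]_n}).-tuple 'M[C]_n) :
    basis_of fullv e -> (forall X, f X = \sum_i trdot X (P i) *: Q i) ->
  \tr (mxof e e f) = \sum_i trdot (Q i) (P i).
Proof.
move=> be fE; transitivity (\sum_k coord e k (f e`_k)).
  by apply: eq_bigr => k _; rewrite !mxE /= vecof_delta.
under eq_bigr do rewrite fE linear_sum.
rewrite exchange_big; apply: eq_bigr => i _ /=.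
(* Expanding [Q i] in [e] inside the pairing makes both sides the sum over [k] of the [k]-th
   coordinate of [Q i] times the pairing of [e_k] with [P i]. *)
rewrite [in RHS](coord_basis be (memvf (Q i))) linear_sumlz /=.
by apply: eq_bigr => k _; rewrite linearZ linearZl_LR /= mulrC.
Qed.

Lemma orth_measure_orthonormal d1 d2 (E : 'I_d1 -> 'M[C]_n)
    (F : 'I_d2 -> 'M[C]_n) A B :
    (forall i j, trdot (E i) (E j) = (i == j)%:R) ->
    (forall Y, Y \in A <-> exists a : 'I_d1 -> C, Y = \sum_i a i *: E i) ->
    (forall i j, trdot (F i) (F j) = (i == j)%:R) ->
    (forall Y, Y \in B <-> exists b : 'I_d2 -> C, Y = \sum_i b i *: F i) ->
  orth_measure A B = \sum_i \sum_j `|trdot (E i) (F j)| ^+ 2.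
Proof.
move=> orthE spanE orthF spanF; have be := vbasisP {:'M[C]_n}.
(* In the row-vector convention the product of the two matrices represents the map applying
   [cond_exp A] first. *)
rewrite /orth_measure -mxof_comp // pair_bigA /=.
pose P (p : 'I_d1 * 'I_d2) := E p.1.
pose Q (p : 'I_d1 * 'I_d2) := trdot (E p.1) (F p.2) *: F p.2.
rewrite (@mxtrace_mxof_finite_rank _ P Q) // => [|X].
  by apply: eq_bigr => p _; rewrite /Q linearZl_LR /= (trdotC (E _)) normCK.
rewrite comp_lfunE (cond_exp_orthonormal _ orthE spanE) linear_sum.
rewrite -(pair_bigA _ (fun i j =>
  trdot X (E i) *: (trdot (E i) (F j) *: F j))) /=.
apply: eq_bigr => i _.
by rewrite linearZ /= (cond_exp_orthonormal _ orthF spanF) scaler_sumr.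
Qed.

End OrthonormalFamilies.

Section BlockScalar.
Context {C : numClosedFieldType} {n : nat}.
Implicit Types U V : 'M[C]_n.

Definition block_of d (m : 'I_d -> nat) (hm : (\sum_k m k)%N = n) (p : 'I_n) :=
  tagnat.sig1 (cast_ord (esym hm) p).

Lemma sum_blocks d (m : 'I_d -> nat) (hm : (\sum_k m k)%N = n)
    (F : 'I_n -> C) :
  \sum_p F p = \sum_k \sum_(a < m k) F (cast_ord hm (tagnat.Rank k a)).
Proof.
case: n / hm F => F.
rewrite (reindex _ tagnat.rank_bij_on) /= sig_big_dep /=.
by apply: eq_bigr => -[k a] _; rewrite cast_ord_id.
Qed.

Lemma block_of_Rank d (m : 'I_d -> nat) (hm : (\sum_k m k)%N = n) k
    (a : 'I_(m k)) : block_of hm (cast_ord hm (tagnat.Rank k a)) = k.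
Proof. by rewrite /block_of cast_ordK tagnat.Rank1K. Qed.

Lemma block_scalar_mxE d (m : 'I_d -> nat) (hm : (\sum_k m k)%N = n)
    (a : 'I_d -> C) :
  block_scalar_mx hm a = diag_mx (\row_p a (block_of hm p)).
Proof.
apply/matrixP => p q; rewrite castmxE !mxE /block_of.
set s := cast_ord _ p; set t := cast_ord _ q.
have -> : (p == q) = (s == t) by rewrite (inj_eq (@cast_ord_inj _ _ _)).
have [<-|st] := eqVneq s t; first by rewrite eqxx conform_mx_id mxE eqxx.
case: eqP => [e|_]; last by rewrite mxE mulr0n.
(* Same block, distinct indices: the positions inside the block must differ, and they become
   comparable once [e] identifies their types. *)
rewrite -(tagnat.sig2K s) -(tagnat.sig2K t) in st.
move: (tagnat.sig2 s) (tagnat.sig2 t) st; rewrite -e => i j.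
by rewrite conform_mx_id mxE; have [->|] := eqVneq i j; rewrite ?eqxx.
Qed.

(** Between diagonal matrices the trace is a weighted sum of the squared moduli of the entries of
    [U ^t* *m V], and the weights are constant on blocks. *)
Lemma trdot_block_scalar d1 d2 (r : 'I_d1 -> nat) (c : 'I_d2 -> nat)
    (hr : (\sum_k r k)%N = n) (hc : (\sum_k c k)%N = n) U V
    (a : 'I_d1 -> C) (b : 'I_d2 -> C) :
  trdot (U *m block_scalar_mx hr a *m U ^t*)
        (V *m block_scalar_mx hc b *m V ^t*) =
  \sum_i \sum_j a i * (b j)^* * \sum_k \sum_l
      submxblock (castmx (esym hr, esym hc) (block_index_matrix U V)) i j k l.
Proof.
rewrite trdot_unitary_conj !block_scalar_mxE /block_index_matrix.
set W := U ^t* *m V.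
transitivity (\sum_p \sum_q a (block_of hr p) * (b (block_of hc q))^* *
    (W p q * (W p q)^*)).
  apply: eq_bigr => p _; rewrite mxE; apply: eq_bigr => q _.
  rewrite mul_diag_mx mul_mx_diag !mxE rmorphM [RHS]mulrACA.
  by congr (_ * _); rewrite mulrC.
rewrite (sum_blocks hr); apply: eq_bigr => i _.
under [LHS]eq_bigr do rewrite (sum_blocks hc).
rewrite [LHS]exchange_big; apply: eq_bigr => j _ /=.
rewrite mulr_sumr; apply: eq_bigr => k _; rewrite mulr_sumr.
apply: eq_bigr => l _.
by rewrite !block_of_Rank !mxE castmxE !mxE !esymK.
Qed.

(** For unitary [U], a rank [m i] projection divided by its Frobenius norm. *)
Definition block_unit d (m : 'I_d -> nat) (hm : (\sum_k m k)%N = n) U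
    (i : 'I_d) : 'M[C]_n :=
  U *m block_scalar_mx hm (fun k => (k == i)%:R / sqrtC (m i)%:R) *m U ^t*.

Lemma trdot_block_unit d1 d2 (r : 'I_d1 -> nat) (c : 'I_d2 -> nat)
    (hr : (\sum_k r k)%N = n) (hc : (\sum_k c k)%N = n) U V i j :
  trdot (block_unit hr U i) (block_unit hc V j) =
  block_sum_mx hr hc (block_index_matrix U V) i j.
Proof.
rewrite trdot_block_scalar (bigD1 i) //= [X in _ + X]big1 ?addr0; last first.
  by move=> k ki; rewrite big1 // => l _; rewrite (negPf ki) !mul0r.
rewrite (bigD1 j) //= [X in _ + X]big1 ?addr0; last first.
  by move=> l lj; rewrite (negPf lj) mul0r conjC0 mulr0 mul0r.
rewrite !eqxx mxE !mul1r; congr (_ * _).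
(* The conjugate on the second coefficient disappears because the root of [c j] is real. *)
by rewrite natrM sqrtCM ?nnegrE ?ler0n // invfM [_^*]conj_Creal // rpredV
  ger0_real // sqrtC_ge0.
Qed.

(** This is [trdot_block_unit] with [V = U]: the block-index matrix is then the identity, whose
    [(i, i)] block sums to [m i] and cancels the normalization. *)
Lemma block_unit_orthonormal d (m : 'I_d -> nat) (hm : (\sum_k m k)%N = n) U :
    (forall k, (0 < m k)%N) -> U \is unitarymx ->
  forall i j, trdot (block_unit hm U i) (block_unit hm U j) = (i == j)%:R.
Proof.
move=> m_gt0 unitaryU i j; rewrite trdot_block_unit mxE.
have -> : block_index_matrix U U = 1%:M.
  have UU : U ^t* *m U = 1%:M.
    by rewrite -invmx_unitary // mulVmx // unitarymx_unit.
  rewrite /block_index_matrix UU; apply/matrixP => p q; rewrite !mxE.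
  by case: eqP => _; rewrite ?conjC1 ?mulr1 ?mul0r.
have [<-|ij] := eqVneq i j; last first.
  rewrite big1 ?mulr0 // => k _; rewrite big1 // => l _.
  rewrite mxE castmxE mxE (inj_eq (@cast_ord_inj _ _ _)).
  by rewrite -val_eqE tagnat.eq_Rank (negPf ij).
have -> : \sum_k \sum_l submxblock (castmx (esym hm, esym hm) 1%:M) i i k l
    = (m i)%:R :> C.
  rewrite -[RHS]mxtrace1; apply: eq_bigr => k _.
  rewrite (bigD1 k) //= [X in _ + X]big1 ?addr0.
    by rewrite mxE castmxE !mxE !eqxx.
  move=> l lk; rewrite mxE castmxE mxE (inj_eq (@cast_ord_inj _ _ _)).
  by rewrite -val_eqE tagnat.eq_Rank eqxx val_eqE eq_sym (negPf lk).
rewrite natrM sqrtCM ?nnegrE ?ler0n // -expr2 sqrtCK mulVf //.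
by rewrite pnatr_eq0 -lt0n.
Qed.

Lemma block_unit_span d (m : 'I_d -> nat) (hm : (\sum_k m k)%N = n) U
    (A : {vspace 'M[C]_n}) :
    (forall k, (0 < m k)%N) ->
    (forall M, M \in A <->
       exists a : 'I_d -> C, M = U *m block_scalar_mx hm a *m U ^t*) ->
  forall M, M \in A <->
    exists a : 'I_d -> C, M = \sum_i a i *: block_unit hm U i.
Proof.
move=> m_gt0 defA M.
have sqrt_neq0 i : sqrtC (m i)%:R != 0 :> C.
  by rewrite sqrtC_eq0 pnatr_eq0 -lt0n.
have combE (a : 'I_d -> C) : \sum_i a i *: block_unit hm U i =
    U *m block_scalar_mx hm (fun i => a i / sqrtC (m i)%:R) *m U ^t*.
  under eq_bigr do rewrite /block_unit scalemxAl scalemxAr.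
  rewrite -mulmx_suml -mulmx_sumr; congr (_ *m _ *m _).
  apply/matrixP => p q; rewrite summxE block_scalar_mxE !mxE.
  under eq_bigr do rewrite block_scalar_mxE !mxE.
  case: eqP => _; last by rewrite big1 // => i _; rewrite mulr0.
  (* At diagonal position [p] only the unit of the block containing [p] is nonzero. *)
  rewrite (bigD1 (block_of hm p)) //= big1 => [|i ip].
    by rewrite !mulr1n eqxx mul1r addr0.
  by rewrite eq_sym (negPf ip) mul0r mulr0.
split=> [/defA[a ->] | [a ->]]; last first.
  by apply/defA; exists (fun i => a i / sqrtC (m i)%:R).
(* These coefficients undo the division by the nonzero root of [m i]. *)
exists (fun i => a i * sqrtC (m i)%:R); rewrite combE !block_scalar_mxE.
by congr (_ *m diag_mx _ *m _); apply/rowP => p; rewrite !mxE mulfK.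
Qed.

End BlockScalar.

Local Open Scope complex_scope.

Theorem theorem3p2 (R : realType) (n d1 d2 : nat)
    (A B : {vspace 'M[R[i]]_n}) (U V : 'M[R[i]]_n)
    (r : 'I_d1 -> nat) (c : 'I_d2 -> nat)
    (r_gt0 : forall k, (0 < r k)%N) (c_gt0 : forall k, (0 < c k)%N)
    (hr : (\sum_k r k)%N = n) (hc : (\sum_k c k)%N = n)
    (algA : unital_star_subalgebra A) (algB : unital_star_subalgebra B)
    (comA : commutative_subalgebra A) (comB : commutative_subalgebra B)
    (unitaryU : U \is unitarymx) (unitaryV : V \is unitarymx)
    (defA : forall M : 'M[R[i]]_n, M \in A <->
       exists a : 'I_d1 -> R[i], M = U *m block_scalar_mx hr a *m U ^t*)
    (defB : forall M : 'M[R[i]]_n, M \in B <->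
       exists b : 'I_d2 -> R[i], M = V *m block_scalar_mx hc b *m V ^t*) :
  orth_measure A B =
    frobenius_norm (block_sum_mx hr hc (block_index_matrix U V)) ^+ 2.
Proof.
rewrite (orth_measure_orthonormal
  (block_unit_orthonormal hr r_gt0 unitaryU) (block_unit_span r_gt0 defA)
  (block_unit_orthonormal hc c_gt0 unitaryV) (block_unit_span c_gt0 defB)).
(* Squaring removes the root in the Frobenius norm, so both sides are double sums compared entry by
   entry. *)
rewrite sqrtCK; apply: eq_bigr => i _; apply: eq_bigr => j _.
by rewrite trdot_block_unit.
Qed.
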